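(* Let $C$ be a $d$-dimensional Archimedean copula with generator $\psi\in\Psi_d$. For $\boldsymbol{t}\in(0,1]^d$ such that $C(\boldsymbol{t})>0$, let $$\tilde\psi(t)=\frac{\psi(t+\psi^{-1}[C(\boldsymbol{t})])}{C(\boldsymbol{t})},\quad t\in[0,\infty),$$ with corresponding $\tilde\psi^{-1}[u]=\psi^{-1}[C(\boldsymbol{t})u]-\psi^{-1}[C(\boldsymbol{t})]$, $u\in[0,1]$. Then the copula $C_{\boldsymbol{t}}$ of $C$ right-truncated at $\boldsymbol{t}$ is given by $$C_{\boldsymbol{t}}(\boldsymbol{u})=\frac{\psi\bigl(\sum_{j=1}^d \psi^{-1}[C(\boldsymbol{t})u_j]-(d-1)\psi^{-1}[C(\boldsymbol{t})]\bigr)}{C(\boldsymbol{t})}=\tilde\psi\Bigl(\sum_{j=1}^d\tilde\psi^{-1}[u_j]\Bigr),\quad\boldsymbol{u}\in[0,1]^d,$$ that is, $C_{\boldsymbol{t}}$ is Archimedean with tilted generator $\tilde\psi(t)=\psi(t+h)/\psi(h)$ and tilt $h=\psi^{-1}[C(\boldsymbol{t})]$.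
   Context: For $\boldsymbol{U}\sim C$ ($C$ a $d$-dimensional copula) and $\boldsymbol{t}\in(0,1]^d$ with $C(\boldsymbol{t})>0$, the right-truncated copula $C_{\boldsymbol{t}}$ is the (unique) copula of the conditional distribution of $\boldsymbol{U}$ given $\boldsymbol{U}\le\boldsymbol{t}$ (componentwise). An Archimedean generator is a continuous, non-increasing function $\psi:[0,\infty)\to[0,1]$ with $\psi(0)=1$, $\lim_{t\to\infty}\psi(t)=0$, strictly decreasing on $[0,\inf\{t:\psi(t)=0\})$; $\psi^{-1}$ denotes its inverse on $(0,1]$, with $\psi^{-1}[0]=\inf\{t:\psi(t)=0\}$ (equal to $\infty$ if $\psi>0$ everywhere) and $\psi(\infty)=0$. A copula $C$ is Archimedean with generator $\psi$ if $C(\boldsymbol{u})=\psi(\psi^{-1}[u_1]+\dots+\psi^{-1}[u_d])$, $\boldsymbol{u}\in[0,1]^d$. $\Psi_d$ is the set of all Archimedean generators which generate a $d$-dimensional Archimedean copula. For a tilt $h\ge0$ (with $\psi(h)>0$), the tilted generator is $t\mapsto\psi(t+h)/\psi(h)$. *)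

(* Defs.v *)
From HB Require Import structures.
From mathcomp Require Import all_boot all_order all_algebra.
From mathcomp Require Import all_classical all_reals all_analysis.
Set Implicit Arguments.
Unset Strict Implicit.
Unset Printing Implicit Defensive.
Import Order.TTheory GRing.Theory Num.Theory.
Import numFieldNormedType.Exports.
Local Open Scope classical_set_scope.
Local Open Scope ring_scope.

(* A copula, and any joint distribution function, is a function
   ('I_d -> R) -> R; the values of a copula outside of [0,1]^d are junk and no
   definition below depends on them. *)
Definition unit_cube (R : realType) (d : nat) : set ('I_d -> R) :=
  [set u | forall j, 0 <= u j <= 1].

Section random_vectors.
Context (R : realType) (d : nat) (dT : measure_display) (T : measurableType dT).
Implicit Types (P : probability T R) (X : 'I_d -> {mfun T >-> R}).

(* The event {X <= x}, componentwise. *)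
Definition lower_event X (x : 'I_d -> R) : set T :=
  [set w | forall j, X j w <= x j].

Lemma measurable_lower_event X x : measurable (lower_event X x).
Proof.
rewrite (_ : lower_event X x = \bigcap_(j in [set: 'I_d]) (X j @^-1` `]-oo, x j])).
  apply: fin_bigcap_measurable => // j _.
  by rewrite -[_ @^-1` _]setTI; exact: measurable_funP.
by apply/seteqP; split=> [w Xx j _|w Xx j] /=;
  [rewrite in_itv /=; exact: Xx | have := Xx j I; rewrite /= in_itv].
Qed.

Definition joint_cdf P X (x : 'I_d -> R) : R := fine (P (lower_event X x)).

Definition margin_cdf P X (j : 'I_d) (y : R) : R := fine (cdf (P := P) (X j) y).

(* U ~ C for a copula C: the margins of U are uniform on (0,1), and C is the
   restriction to [0,1]^d of the distribution function of U. *)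
Definition distributed_as P X (C : ('I_d -> R) -> R) : Prop :=
  (forall j (A : set R), measurable A ->
     distribution P (X j) A = uniform_prob (@ltr01 R) A) /\
  (forall u, unit_cube u -> joint_cdf P X u = C u).

(* The conditional probability P( . | X <= t); mnormalize returns its default
   argument P when the conditioning event has probability 0. *)
Definition truncated_prob P X (t : 'I_d -> R) : probability T R :=
  mnormalize (mrestr P (measurable_lower_event X t)) P.

End random_vectors.

Definition is_copula (R : realType) (d : nat) (C : ('I_d -> R) -> R) : Prop :=
  exists (dT : measure_display) (T : measurableType dT) (P : probability T R)
    (U : 'I_d -> {mfun T >-> R}), distributed_as P U C.

(* D is a copula of the law of X under P, in the sense of Sklar's theorem. *)
Definition is_copula_of (R : realType) (d : nat) (dT : measure_display)
    (T : measurableType dT) (P : probability T R) (X : 'I_d -> {mfun T >-> R})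
    (D : ('I_d -> R) -> R) : Prop :=
  is_copula D /\
  forall x : 'I_d -> R, joint_cdf P X x = D (fun j => margin_cdf P X j (x j)).

Definition right_truncated_copula (R : realType) (d : nat) (dT : measure_display)
    (T : measurableType dT) (P : probability T R) (U : 'I_d -> {mfun T >-> R})
    (t : 'I_d -> R) (Ct : ('I_d -> R) -> R) : Prop :=
  is_copula_of (truncated_prob P U t) U Ct.

Section generators.
Context (R : realType).
Implicit Types (psi : R -> R).

(* psi extended by psi(oo) = 0; only values in [0, +oo] are meaningful. *)
Definition gen_ext psi (x : \bar R) : R := if x is r%:E then psi r else 0.

(* For 0 < u <= 1 this is the inverse of a generator psi (see gen_invE); for
   u = 0 it is inf {t : psi t = 0}, which is +oo when psi never vanishes. *)
Definition gen_inv psi (u : R) : \bar R :=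
  ereal_inf [set t%:E | t in [set t : R | 0 <= t /\ psi t = u]].

(* Generators are total functions R -> R used on [0, +oo[ only. *)
Definition is_generator psi : Prop :=
  [/\ {within `[0, +oo[, continuous psi},
      (forall x, 0 <= x -> 0 <= psi x <= 1),
      (forall x y, 0 <= x -> x <= y -> psi y <= psi x),
      psi 0 = 1 /\ psi x @[x --> +oo] --> (0 : R) &
      (forall x y, 0 <= x -> x < y -> (y%:E < gen_inv psi 0)%E ->
         psi y < psi x)].

Lemma gen_invE psi (t : R) : is_generator psi -> 0 <= t -> 0 < psi t ->
  gen_inv psi (psi t) = t%:E.
Proof.
move=> [_ _ mono _ strict] t0 pt.
have no_lt s r : 0 <= s -> s < r -> psi s = psi r -> 0 < psi r -> False.
  move=> s0 sr eq_sr pr.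
  have sm : s < (s + r) / 2 by rewrite midf_lt.
  have mr : (s + r) / 2 < r by rewrite midf_lt.
  have r_le : (r%:E <= gen_inv psi 0)%E.
    apply: le_ereal_inf_tmp => _ [z [z0 pz]] <-; rewrite lee_fin leNgt.
    apply/negP => /ltW zr.
    by have := mono _ _ z0 zr; rewrite pz leNgt pr.
  have := strict _ _ s0 sm (lt_le_trans _ r_le).
  rewrite lte_fin => /(_ mr).
  by rewrite eq_sr ltNge (mono _ _ (le_trans s0 (ltW sm)) (ltW mr)).
rewrite /gen_inv (_ : [set s%:E | s in _] = [set t%:E]) ?ereal_inf1//.
apply/seteqP; split=> [_ [s [s0 st] <-]|_ ->]; last by exists t.
case: (ltgtP s t) => [lt|lt|->//].
- by case: (no_lt _ _ s0 lt st pt).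
- by case: (no_lt _ _ t0 lt (esym st)); rewrite st.
Qed.

Definition archimedean (d : nat) psi (u : 'I_d -> R) : R :=
  gen_ext psi (\sum_(j < d) gen_inv psi (u j))%E.

Definition Psi (d : nat) : set (R -> R) :=
  [set psi | is_generator psi /\ is_copula (@archimedean d psi)].

Definition is_archimedean (d : nat) psi (C : ('I_d -> R) -> R) : Prop :=
  [/\ is_generator psi, is_copula C &
      forall u, unit_cube u -> C u = archimedean psi u].

Definition tilted psi (h : R) : R -> R := fun x => psi (x + h) / psi h.

End generators.

(* Main.v *)
Require Import Defs.
From HB Require Import structures.
From mathcomp Require Import all_boot all_order all_algebra.
From mathcomp Require Import all_classical all_reals all_analysis.
From mathcomp Require Import measurable_realfun ring lra.
Set Implicit Arguments.
Unset Strict Implicit.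
Unset Printing Implicit Defensive.
Import Order.TTheory GRing.Theory Num.Theory.
Import numFieldNormedType.Exports.
Local Open Scope classical_set_scope.
Local Open Scope ring_scope.

(** Write [a j] for the inverse of the generator at [t j], and [h] for the sum
    of the [a j], so that [C t = psi h]. For [y <= t] in the unit cube, the law
    of [U] given [U <= t] has distribution function
    [psi (\sum_j psi^-1 (y j)) / psi h] and margins
    [psi (h - a j + psi^-1 (y j)) / psi h]. The tilt turns the sum defining
    [C] into the sum defining the tilted copula: the inverse of the tilted
    generator at the [j]-th margin, if nonzero, is [psi^-1 (y j) - a j], and
    these numbers add up to [\sum_j psi^-1 (y j) - h], where the tilted generator takes the
    value of the joint distribution function. This is
    [archimedean_truncated]; what it needs besides algebra is the inverse of
    the tilted generator ([gen_inv_tilted]) and some care with the value 0,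
    at which [gen_inv psi] may be infinite.

    It follows that the Archimedean function of the tilted generator expresses
    the truncated joint distribution function through its margins. Every
    margin takes all the values in [0, 1] ([margin_onto]), and this surjectivity
    gives both halves of Sklar's theorem: at most one function on the cube
    links the joint distribution function to the margins
    ([copula_of_unique]), and any function that does is a copula, namely the
    distribution function of the vector of the margins evaluated at the
    coordinates of [U], under the conditional law ([is_copula_margins]).

    Both distribution functions live on all of R^d, whereas [C] is only known
    on the unit cube. Coordinates are therefore cut off at 0 and [t j]; since
    the margins of [U] are uniform, the cut at 0 changes lower orthant events
    by null sets ([joint_cdf_max0]). *)

(** * Archimedean generators and their inverses *)

Section generator_theory.
Context (R : realType) (psi : R -> R) (gen : is_generator psi).

Lemma gen_inv_ge0 (f : R -> R) u : (0 <= gen_inv f u)%E.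
Proof. by apply: le_ereal_inf_tmp => _ [x [x0 _]] <-; rewrite lee_fin. Qed.

(** The intermediate value theorem between [psi 0 = 1] and a point far out,
    where [psi] is below [u]. *)
Lemma gen_onto u : 0 < u <= 1 -> exists x, 0 <= x /\ psi x = u.
Proof.
case: gen => [cont _ mono [psi0 psioo] _] /andP[u0 u1].
have [x [xu x0]] : exists x, psi x < u /\ 0 <= x.
  have : \forall x \near +oo, psi x < u /\ 0 <= x.
    near=> x; split; last by near: x; exact: nbhs_pinfty_ge.
    by near: x; apply: (cvgr_lt 0).
  by move=> /filter_ex.
have [||z] := @IVT R psi 0 x u x0.
- by apply: continuous_subspaceW cont => y /=; rewrite !in_itv/= andbT => /andP[].
- by rewrite psi0 ge_min le_max u1 (ltW xu) orbT.
- by rewrite in_itv/= => /andP[z0 _] zu; exists z.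
Unshelve. all: by end_near. Qed.

(** When finite, the infimum of the zeros of [psi] is a zero: if [psi x > 0],
    a point [y] with [psi y = psi x / 2] lies strictly between [x] and all the
    zeros. *)
Lemma gen_eq0 x : 0 <= x -> (gen_inv psi 0 <= x%:E)%E -> psi x = 0.
Proof.
case: (gen) => [_ rng mono _ _] x0 zx.
have /andP[px0 px1] := rng _ x0.
apply/eqP; rewrite eq_le px0 andbT leNgt; apply/negP => px.
have [|y [y0 py]] := @gen_onto (psi x / 2); first by apply/andP; split; lra.
have xy : x < y.
  by rewrite ltNge; apply/negP => yx; have := mono _ _ y0 yx; rewrite py; lra.
suff : (y%:E <= gen_inv psi 0)%E.
  by move=> /le_trans /(_ zx); rewrite lee_fin leNgt xy.
apply: le_ereal_inf_tmp => _ [z [z0 pz]] <-; rewrite lee_fin leNgt.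
by apply/negP => /ltW zy; have := mono _ _ z0 zy; rewrite py pz; lra.
Qed.

Lemma gen_ext_ge0 x : (0 <= x)%E -> 0 <= gen_ext psi x.
Proof.
by case: (gen) => [_ rng _ _ _]; case: x => //= x; rewrite lee_fin => /rng/andP[].
Qed.

Lemma gen_ext_nincr x y : (0 <= x)%E -> (x <= y)%E ->
  gen_ext psi y <= gen_ext psi x.
Proof.
case: (gen) => [_ _ mono _ _].
case: x => [x| |]//; case: y => [y| |]//=; last by move=> /(@gen_ext_ge0 x%:E).
by rewrite !lee_fin; exact: mono.
Qed.

Lemma gen_ext_eq0 x : (gen_inv psi 0 <= x)%E -> gen_ext psi x = 0.
Proof.
move=> zx; have := le_trans (gen_inv_ge0 psi 0) zx.
by case: x zx => [x| |]//= zx; rewrite lee_fin => x0; exact: gen_eq0.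
Qed.

Lemma gen_inv_pos u : 0 < u <= 1 ->
  exists x, [/\ 0 <= x, psi x = u & gen_inv psi u = x%:E].
Proof.
move=> /[dup] /andP[u0 _] /gen_onto[x [x0 xu]]; exists x; split => //.
by rewrite -xu gen_invE// xu.
Qed.

Lemma gen_invK u : 0 <= u <= 1 -> gen_ext psi (gen_inv psi u) = u.
Proof.
move=> /andP[]; rewrite le_eqVlt => /predU1P[<- _|u0 u1]; first exact: gen_ext_eq0.
by have [|x [_ xu ->]] := @gen_inv_pos u; rewrite ?u0.
Qed.

Lemma gen_inv_nincr u v : 0 <= u -> u <= v -> v <= 1 ->
  (gen_inv psi v <= gen_inv psi u)%E.
Proof.
case: (gen) => [_ _ mono _ _] u0 uv v1.
apply: le_ereal_inf_tmp => _ [x [x0 xu]] <-.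
have [->|uv'] := eqVneq v u; first by apply: ereal_inf_lbound; exists x.
have uv1 : u < v by rewrite lt_neqAle eq_sym uv' uv.
have [|y [y0 yv ->]] := @gen_inv_pos v; first by rewrite v1 andbT (le_lt_trans u0).
rewrite lee_fin leNgt; apply/negP => /ltW xy.
by have := mono _ _ x0 xy; rewrite xu yv leNgt uv1.
Qed.

Lemma gen_extK x : (0 <= x)%E -> 0 < gen_ext psi x ->
  gen_inv psi (gen_ext psi x) = x.
Proof. by case: x => [x| |]//=; rewrite ?ltxx// lee_fin => x0 /gen_invE ->. Qed.

(** * The tilted generator *)

Section tilt.
Context (h : R) (h0 : 0 <= h) (ph : 0 < psi h).

Let ph1 : psi h <= 1.
Proof. by case: (gen) => [_ /(_ _ h0)/andP[]]. Qed.

(** The points where the tilted generator is [u] are the translates by [- h] of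
    those where [psi] is [psi h * u]: all of the latter lie to the right of [h],
    because [psi h * u <= psi h]. Arguing on infima covers [u = 0] as well. *)
Lemma gen_inv_tilted u : 0 <= u <= 1 ->
  gen_inv (tilted psi h) u = (gen_inv psi (psi h * u) - h%:E)%E.
Proof.
move=> /andP[u0 u1]; apply/eqP; rewrite eq_le; apply/andP; split.
  rewrite leeBrDr//; apply: le_ereal_inf_tmp => _ [y [y0 yu]] <-.
  have hy : h <= y.
    rewrite -lee_fin -(gen_invE gen h0 ph).
    apply: (@le_trans _ _ (gen_inv psi (psi h * u))); last first.
      by apply: ereal_inf_lbound; exists y.
    by rewrite gen_inv_nincr// ?ler_piMr// ?mulr_ge0// ltW.
  rewrite -leeBrDr// -EFinB; apply: ereal_inf_lbound; exists (y - h) => //.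
  by split; rewrite /= ?subr_ge0// /tilted subrK yu mulrC mulKf ?gt_eqF.
apply: le_ereal_inf_tmp => _ [x [x0 xu]] <-.
rewrite leeBlDr// -EFinD; apply: ereal_inf_lbound; exists (x + h) => //.
by split; rewrite /= ?addr_ge0// -xu /tilted mulrC divfK ?gt_eqF.
Qed.

Lemma is_generator_tilted : is_generator (tilted psi h).
Proof.
case: (gen) => [cont rng mono [psi0 psioo] strict]; split.
- apply: (@within_continuous_comp _ _ _ _ (fun x => psi (x + h)) (fun y => y / psi h)).
    by move=> y _; exact: mulrr_continuous.
  (* For [h > 0], translation moves [0] into the open half-line, on which
     [psi] is continuous in the two-sided sense. *)
  have [->|hn0] := eqVneq h 0; first rewrite (_ : (fun x => _) = psi)//.
    by apply/funext => x; rewrite addr0.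
  apply: continuous_subspace_itv => x; rewrite in_itv/= andbT => x0.
  apply: (@continuous_comp _ _ _ (fun x => x + h) psi).
    by apply: cvgD; [exact: cvg_id|exact: cvg_cst].
  have [+ _] := (continuous_within_itvcyP 0 psi).1 cont; apply.
  by rewrite in_itv/= andbT ltr_wpDl// lt_neqAle eq_sym hn0.
- move=> x x0; have xh0 := addr_ge0 x0 h0; have /andP[pxh _] := rng _ xh0.
  rewrite /tilted divr_ge0 ?(ltW ph)//= ler_pdivrMr// mul1r.
  by apply: mono => //; rewrite lerDr.
- move=> x y x0 xy; rewrite /tilted ler_pM2r ?invr_gt0//.
  by apply: mono; rewrite ?lerD2r// addr_ge0.
- rewrite /tilted add0r divff ?gt_eqF//; split=> //.
  rewrite -[X in _ --> X](mul0r (psi h)^-1); apply: cvgMl.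
  by rewrite (cvg_shiftr h psi).
- move=> x y x0 xy; rewrite gen_inv_tilted ?lexx ?ler01// mulr0 lteBrDr// => yh.
  rewrite /tilted ltr_pM2r ?invr_gt0//.
  by apply: strict; rewrite ?addr_ge0 ?ltrD2r.
Qed.

Lemma gen_ext_tilted x :
  gen_ext (tilted psi h) x = gen_ext psi (x + h%:E)%E / psi h.
Proof. by case: x => [x| |]//=; rewrite mul0r. Qed.

Lemma archimedean_tiltedE d (u : 'I_d -> R) : unit_cube u ->
  archimedean (tilted psi h) u =
  gen_ext psi (\sum_(j < d) gen_inv psi (psi h * u j)%R
               - (d%:R - 1)%:E * h%:E)%E / psi h.
Proof.
move=> uu; rewrite /archimedean gen_ext_tilted; congr (gen_ext _ _ / _).
under eq_bigr do rewrite gen_inv_tilted//.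
have -> : (\sum_(j < d) (gen_inv psi (psi h * u j)%R - h%:E)%E =
    \sum_(j < d) gen_inv psi (psi h * u j)%R - (d%:R * h)%R%:E)%E.
  by rewrite big_split/= sumEFin sumr_const card_ord mulNrn mulr_natl.
have shift (S : \bar R) : (S - (d%:R * h)%:E + h%:E = S - (d%:R - 1)%:E * h%:E)%E.
  by case: S => //= s; congr (_%:E); ring.
exact: shift.
Qed.

End tilt.

(** * Truncating an Archimedean function *)

Definition update d (t : 'I_d -> R) j y : 'I_d -> R :=
  fun k => if k == j then y else t k.

Section truncation.
Context (d : nat) (t a : 'I_d -> R).
Context (t01 : forall j, 0 < t j <= 1).
Context (a0 : forall j, 0 <= a j) (ta : forall j, gen_inv psi (t j) = (a j)%:E).
Let h := \sum_(j < d) a j.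
Context (ph : 0 < psi h).

Let h0 : 0 <= h. Proof. exact: sumr_ge0. Qed.

Let a_le_h j : a j <= h.
Proof. by rewrite /h (bigD1 j)//= lerDl sumr_ge0. Qed.

Lemma archimedean_update j y :
  archimedean psi (update t j y) = gen_ext psi ((h - a j)%:E + gen_inv psi y)%E.
Proof.
rewrite /archimedean (bigD1 j)//= /update eqxx; congr gen_ext.
rewrite [RHS]addeC; congr (_ + _)%E.
rewrite [in RHS]/h [in RHS](bigD1 j)//= addrAC subrr add0r -sumEFin.
by apply: eq_bigr => k /negPf ->.
Qed.

(** For [u > 0] let [psi s = psi h * u]. The margin takes the value [u] at
    [y = psi (s - h + a j)], and [s >= h] yields [y <= psi (a j) = t j]. *)
Lemma margin_onto j u : 0 <= u <= 1 ->
  exists y, 0 <= y <= t j /\ archimedean psi (update t j y) = psi h * u.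
Proof.
move=> /andP[]; rewrite le_eqVlt => /predU1P[<- _|u0 u1].
  exists 0; split; first by have /andP[/ltW ->] := t01 j; rewrite lexx.
  rewrite archimedean_update mulr0; apply: gen_ext_eq0.
  by rewrite leeDr// lee_fin subr_ge0.
case: (gen) => [_ rng mono _ _].
have ph1 : psi h <= 1 by have /andP[] := rng _ h0.
have hu : 0 < psi h * u <= 1 by rewrite mulr_gt0//= mulr_ile1// ltW.
have [s [s0 ps sE]] := gen_inv_pos hu.
have hs : h <= s.
  rewrite -lee_fin -sE -(gen_invE gen h0 ph) gen_inv_nincr//.
  - by case/andP: hu => /ltW.
  - by rewrite ler_piMr// ltW.
pose x := s - h + a j.
have ax : a j <= x by rewrite /x; lra.
have x0 : 0 <= x by exact: le_trans ax.
(* [gen_invE] needs [psi x > 0], which holds because [x <= s]. *)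
have px : 0 < psi x.
  case/andP: hu => hu _; apply: (lt_le_trans hu); rewrite -ps.
  by apply: mono => //; have := a_le_h j; rewrite /x; lra.
have tj : t j = psi (a j).
  by have := gen_invK (u := t j); rewrite ta/= => -> //; case/andP: (t01 j) => /ltW ->.
exists (psi x); split; first by rewrite (ltW px) tj/= mono.
rewrite archimedean_update gen_invE//= -ps; congr psi; rewrite /x; lra.
Qed.

(** With [e j = h - a j + psi^-1 (y j)], the [j]-th margin is
    [psi (e j) / psi h]. If no margin vanishes then [gen_inv psi] inverts
    [psi] at every [e j], and summing the [e j - h] gives the claim. If
    [psi (e j) = 0], the left side vanishes because [e j] is at most the sum of
    the [psi^-1 (y k)], and the right side because one of its arguments is 0. *)
Lemma archimedean_truncated (y : 'I_d -> R) : (forall j, 0 <= y j <= t j) ->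
  archimedean psi y / psi h =
  archimedean (tilted psi h)
    (fun j => archimedean psi (update t j (y j)) / psi h).
Proof.
move=> yt; rewrite [RHS]/archimedean gen_ext_tilted; congr (_ / _).
have ab j : ((a j)%:E <= gen_inv psi (y j))%E.
  have /andP[y0 ytj] := yt j; rewrite -ta gen_inv_nincr//.
  by case/andP: (t01 j).
pose e j := ((h - a j)%:E + gen_inv psi (y j))%E.
have he j : (h%:E <= e j)%E.
  rewrite /e -[leLHS](_ : (h - a j)%:E + (a j)%:E = _)%E ?leeD2l//.
  by rewrite -EFinD subrK.
have e0 j : (0 <= e j)%E by apply: le_trans (he j); rewrite lee_fin.
have m01 j : 0 <= archimedean psi (update t j (y j)) / psi h <= 1.
  rewrite archimedean_update; apply/andP; split.
    by rewrite divr_ge0 ?(ltW ph)//; exact: gen_ext_ge0 (e0 j).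
  rewrite ler_pdivrMr// mul1r -[leRHS]/(gen_ext psi h%:E).
  by apply: gen_ext_nincr; [rewrite lee_fin|exact: he].
have mE : forall j, gen_inv (tilted psi h) (archimedean psi (update t j (y j)) / psi h)
    = (gen_inv psi (gen_ext psi (e j)) - h%:E)%E.
  by move=> j; rewrite gen_inv_tilted// mulrC divfK ?gt_eqF// archimedean_update.
have [[j ej]|e_gt0] := pselect (exists j, gen_ext psi (e j) = 0).
  transitivity (0 : R); last (apply/esym; apply: gen_ext_eq0); last first.
    rewrite -leeBlDr//.
    rewrite (bigD1 j)//= mE ej leeDl// sume_ge0// => k _; exact: gen_inv_ge0.
  apply/eqP; rewrite eq_le gen_ext_ge0 ?sume_ge0 ?andbT//; last first.
    by move=> k _; exact: gen_inv_ge0.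
  rewrite -ej; apply: gen_ext_nincr => //.
  rewrite /e addeC (bigD1 j)//= leeD2l// /h (bigD1 j)//= addrAC subrr add0r.
  by rewrite -sumEFin lee_sum.
have {}e_gt0 j : 0 < gen_ext psi (e j).
  rewrite lt_neqAle gen_ext_ge0// andbT eq_sym.
  by apply/eqP => ej; apply: e_gt0; exists j.
have {}mE : forall j, gen_inv (tilted psi h) (archimedean psi (update t j (y j)) / psi h)
    = ((fine (gen_inv psi (y j)) - a j)%:E)%E /\
    gen_inv psi (y j) = (fine (gen_inv psi (y j)))%:E.
  move=> j; rewrite mE gen_extK// /e; have := e_gt0 j; rewrite /e.
  case: (gen_inv psi (y j)) => [b| |]//=; rewrite ?ltxx// => _; split => //.
  by congr (_%:E); ring.
under [in RHS]eq_bigr do rewrite (mE _).1.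
rewrite /archimedean; under [in LHS]eq_bigr do rewrite (mE _).2.
by rewrite !sumEFin -EFinD sumrB /h subrK.
Qed.

End truncation.
End generator_theory.

(** * The uniform law *)

Section uniform_law.
Context (R : realType).
Implicit Types (mu nu : probability (measurableTypeR R) R).

(** Half-open bounded intervals generate the Borel sets, are stable under
    intersection, and are differences of half-lines. *)
Lemma probability_eq_itvNy mu nu :
  (forall x, mu `]-oo, x]%classic = nu `]-oo, x]%classic) ->
  forall A, measurable A -> mu A = nu A.
Proof.
move=> munu.
apply: (@measure_unique _ R (measurableTypeR R) (@ocitv R)
  (fun n : nat => `]- n%:R, n%:R]%classic)) => //.
- exact: ocitvI.
- by move=> n; exists (- n%:R, n%:R).
- apply/seteqP; split=> // x _; exists (Num.truncn `|x|).+1 => //=.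
  have := truncnS_gt `|x|; rewrite ltr_norml in_itv/= => /andP[-> /ltW].
  exact.
- move=> _ [[a b] _ <-] /=.
  have [ab|ba] := leP a b; last first.
    by rewrite set_itv_ge ?measure0// bnd_simp -leNgt ltW.
  have -> : `]a, b]%classic = `]-oo, b] `\` `]-oo, a].
    by rewrite -[RHS]setCK setCD setCitvl setUC -[LHS]setCK setCitv.
  have sub : `]-oo, a] `<=` `]-oo, b] by apply: subset_itvl; rewrite bnd_simp.
  rewrite !measureD ?(setIidr sub)//.
  + by congr (_ - _)%E; exact: munu.
  + by rewrite -ge0_fin_numE// fin_num_measure.
  + by rewrite -ge0_fin_numE// fin_num_measure.
- by move=> n; rewrite -ge0_fin_numE// fin_num_measure.
Qed.

Lemma uniform_prob_itvNy (x : R) : 0 <= x <= 1 ->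
  uniform_prob (@ltr01 R) `]-oo, x]%classic = x%:E.
Proof.
move=> /andP[x0 x1]; rewrite /uniform_prob integral_uniform_pdf.
have -> : `]-oo, x] `&` `[0, 1] = `[0, x]%classic :> set R.
  apply/seteqP; split=> [y|y]/=; rewrite !in_itv/=.
    by move=> [yx /andP[-> _]].
  by move=> /andP[y0 yx]; rewrite yx y0 (le_trans yx).
rewrite (eq_integral (fun=> 1%:E)); last first.
  move=> y; rewrite inE/= in_itv/= /uniform_pdf => /andP[-> yx].
  by rewrite (le_trans yx)// subr0 invr1.
rewrite integral_cst//= mul1e lebesgue_measure_itv/= lte_fin.
by move: x0; rewrite le_eqVlt => /predU1P[<-|->]; rewrite ?ltxx// sube0.
Qed.

Lemma uniform_lawP mu :
  (forall x, 0 <= x <= 1 -> mu `]-oo, x]%classic = x%:E) ->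
  forall A, measurable A -> mu A = uniform_prob (@ltr01 R) A.
Proof.
move=> mux; apply: probability_eq_itvNy => x.
(* Monotonicity determines the distribution function outside of [0, 1]. *)
have clamp (nu : probability (measurableTypeR R) R) :
    (forall x, 0 <= x <= 1 -> nu `]-oo, x]%classic = x%:E) ->
    nu `]-oo, x]%classic = (Num.max 0 (Num.min x 1))%:E :> \bar R.
  move=> nux; have [x0|x0] := ltP x 0; last have [x1|x1] := leP x 1.
  - have x1 : x <= 1 by lra.
    rewrite (min_idPl x1) (max_idPl (ltW x0)).
    apply/eqP; rewrite eq_le measure_ge0 andbT -(nux 0) ?lexx ?ler01//.
    by apply: le_measure; rewrite ?inE//; apply: subset_itvl; rewrite bnd_simp ltW.
  - by rewrite (max_idPr x0) nux ?x0.
  - rewrite (max_idPr ler01).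
    apply/eqP; rewrite eq_le probability_le1//= -(nux 1) ?lexx ?ler01//.
    by apply: le_measure; rewrite ?inE//; apply: subset_itvl; rewrite bnd_simp ltW.
by rewrite !clamp//; exact: uniform_prob_itvNy.
Qed.
End uniform_law.

(** * Sklar's theorem for surjective margins *)

Section null_modification.
Context (R : realType) (dT : measure_display) (T : measurableType dT).
Context (mu : {measure set T -> \bar R}).

(** The difference of the two intersections is covered by the finitely many
    null sets [B j `\` A j]. *)
Lemma measure_forall_null (d : nat) (A B : 'I_d -> set T) :
  (forall j, measurable (A j)) -> (forall j, measurable (B j)) ->
  (forall j, A j `<=` B j) -> (forall j, mu (B j `\` A j) = 0%E) ->
  mu [set w | forall j, A j w] = mu [set w | forall j, B j w].
Proof.
move=> mA mB AB muBA.
have bigE (F : 'I_d -> set T) :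
    [set w | forall j, F j w] = \bigcap_(j in [set: 'I_d]) F j.
  by apply/seteqP; split=> [w Fw j _|w Fw j]; [exact: Fw|exact: (Fw j I)].
have mF (F : 'I_d -> set T) : (forall j, measurable (F j)) ->
    measurable [set w | forall j, F j w].
  by move=> mF; rewrite bigE; apply: fin_bigcap_measurable.
pose N := \big[setU/set0]_(j < d) (B j `\` A j).
have [mN muN] : measurable N /\ mu N = 0%E.
  rewrite /N; elim/big_ind : _ => [|X Y [mX X0] [mY Y0]|j _].
  - by rewrite measure0.
  - by split; [exact: measurableU|exact: null_set_setU].
  - by split=> //; exact: measurableD.
apply/eqP; rewrite eq_le; apply/andP; split.
  by apply: le_measure; rewrite ?inE; [exact: mF..|] => w Aw j; exact: AB.
rewrite -[leRHS](measureU0 (mF _ mA) mN muN).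
apply: le_measure; rewrite ?inE; [exact: mF|apply: measurableU => //; exact: mF|].
move=> w Bw; have [Aw|/existsNP[j nAw]] := pselect (forall j, A j w); first by left.
by right; rewrite /N -bigcup_seq; exists j; rewrite //= mem_index_enum.
Qed.
End null_modification.

Section sklar.
Context (R : realType) (d : nat) (dT : measure_display) (T : measurableType dT).
Context (Q : probability T R) (X : 'I_d -> {mfun T >-> R}).
Context (onto : forall j v, 0 <= v <= 1 -> exists x, margin_cdf Q X j x = v).

Lemma joint_cdfE x : Q (lower_event X x) = (joint_cdf Q X x)%:E.
Proof.
by rewrite /joint_cdf fineK// fin_num_measure//; exact: measurable_lower_event.
Qed.

Lemma measurable_margin_event j x : measurable [set w | X j w <= x].
Proof.
rewrite (_ : [set w | _] = X j @^-1` `]-oo, x]).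
  by rewrite -[_ @^-1` _]setTI; exact: measurable_funP.
by apply/seteqP; split=> w /=; rewrite in_itv.
Qed.

Lemma margin_cdfE j x : Q [set w | X j w <= x] = (margin_cdf Q X j x)%:E.
Proof.
by rewrite /margin_cdf fineK// fin_num_measure.
Qed.

Lemma margin_cdf_nd j : {homo margin_cdf Q X j : x y / x <= y}.
Proof.
move=> x y xy; rewrite -lee_fin -!margin_cdfE.
apply: le_measure; rewrite ?inE; [exact: measurable_margin_event..|].
by move=> w /= /le_trans; exact.
Qed.

(** Every point of the cube is a vector of values of the margins. *)
Lemma copula_of_unique (D D' : ('I_d -> R) -> R) :
  (forall x, joint_cdf Q X x = D (fun j => margin_cdf Q X j (x j))) ->
  (forall x, joint_cdf Q X x = D' (fun j => margin_cdf Q X j (x j))) ->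
  forall u, unit_cube u -> D u = D' u.
Proof.
move=> XD XD' u u01.
have [x xu] := choice (fun j => onto j (u01 j)).
have <- : (fun j => margin_cdf Q X j (x j)) = u by apply/funext => j.
by rewrite -XD XD'.
Qed.

(* The probability integral transform of [X j]; composing with the marginal
   distribution functions yields a vector with uniform margins. *)
Let V_subproof j : (margin_cdf Q X j \o X j) \in mfun.
Proof.
rewrite inE; apply: measurableT_comp => //.
exact: nondecreasing_measurable (margin_cdf_nd j).
Qed.

Let V j : {mfun T >-> R} := mfun_Sub (V_subproof j).

(* [V j] into the copy of [R] whose measurable structure is that of
   [uniform_prob]; its law is the measure compared with the uniform one. *)
Let W j : {mfun T >-> measurableTypeR R} :=
  @mfun_Sub _ _ T (measurableTypeR R) _ (V_subproof j).

Let mV j v : measurable [set w | margin_cdf Q X j (X j w) <= v].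
Proof.
rewrite (_ : [set w | _] = V j @^-1` `]-oo, v]).
  by rewrite -[_ @^-1` _]setTI; exact: measurable_funP.
by apply/seteqP; split=> w /=; rewrite in_itv.
Qed.

(* The event contains [X j <= x] for any [x] at which the margin is [v]. It is
   contained in [X j <= x'] whenever the margin at [x'] exceeds [v], so its
   probability is at most any [v' > v]. *)
Let V_law j v : 0 <= v <= 1 -> Q [set w | margin_cdf Q X j (X j w) <= v] = v%:E.
Proof.
move=> v01; apply/eqP; rewrite eq_le; apply/andP; split; last first.
  have [x <-] := onto j v01; rewrite -margin_cdfE.
  apply: le_measure; rewrite ?inE; [exact: measurable_margin_event|exact: mV|].
  by move=> w /= /margin_cdf_nd.
have [v1|v1] := leP 1 v.
  by apply: le_trans (probability_le1 _ (mV j v)) _; rewrite lee_fin.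
apply/lee_addgt0Pr => e e0.
pose v' := Num.min 1 (v + e).
have vv' : v < v' by rewrite lt_min v1 ltrDl.
have v'01 : 0 <= v' <= 1.
  by case/andP: v01 => v0 _; rewrite ge_min lexx/= (le_trans v0) // ltW.
apply: (@le_trans _ _ v'%:E); last by rewrite -EFinD lee_fin ge_min lexx orbT.
have [x xv'] := onto j v'01; rewrite -xv' -margin_cdfE.
apply: le_measure; rewrite ?inE; [exact: mV|exact: measurable_margin_event|].
move=> w /= wv; rewrite leNgt; apply/negP => /ltW /(margin_cdf_nd j).
by rewrite xv' => /le_trans /(_ wv); rewrite leNgt vv'.
Qed.

(** If the margins at [x] are the coordinates of [u], then [V j <= u j] contains
    [X j <= x j] and has the same probability [u j]; hence the distribution
    function of [V] at [u] is that of [X] at [x]. *)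
Lemma is_copula_margins (D : ('I_d -> R) -> R) :
  (forall x, joint_cdf Q X x = D (fun j => margin_cdf Q X j (x j))) ->
  is_copula D.
Proof.
move=> XD; exists dT, T, Q, V; split=> [j A mA|u u01].
  apply: (@uniform_lawP R (distribution Q (W j)) _ A mA) => v v01.
  rewrite -[RHS](V_law j v01).
  by congr (Q _); apply/seteqP; split=> w /=; rewrite in_itv.
have [x xu] := choice (fun j => onto j (u01 j)).
transitivity (joint_cdf Q X x); last first.
  by rewrite XD; congr D; apply/funext.
have sub j : [set w | X j w <= x j] `<=` [set w | margin_cdf Q X j (X j w) <= u j].
  by move=> w /= /margin_cdf_nd; rewrite -xu; exact.
apply: EFin_inj; rewrite -joint_cdfE /joint_cdf fineK; last first.
  by rewrite fin_num_measure//; exact: measurable_lower_event.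
apply/esym/measure_forall_null => // j;
  [exact: measurable_margin_event|exact: mV|].
have mX := measurable_margin_event j (x j).
have fV : (Q [set w | (margin_cdf Q X j (X j w) <= u j)%R] < +oo)%E.
  by rewrite V_law ?ltry.
have := measureD (mV j (u j)) mX fV; rewrite (setIidr (sub j)) /=.
rewrite margin_cdfE xu V_law// subee//; exact.
Qed.

End sklar.

(** * The law conditioned on a lower orthant *)

Section truncated_law.
Context (R : realType) (d : nat) (dT : measure_display) (T : measurableType dT).
Context (P : probability T R) (U : 'I_d -> {mfun T >-> R}) (t : 'I_d -> R).

Lemma truncated_probE A : 0 < joint_cdf P U t ->
  truncated_prob P U t A =
  (P (A `&` lower_event U t) * (joint_cdf P U t)^-1%:E)%E.
Proof.
have tE : mrestr P (measurable_lower_event U t) setT = (joint_cdf P U t)%:E.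
  by rewrite /mrestr setTI joint_cdfE.
move=> pt; rewrite -[X in (X^-1)%:E]/(fine (joint_cdf P U t)%:E) -tE.
rewrite /truncated_prob/= /mnormalize; case: ifPn => // /orP[] /eqP.
  by move=> P0; case: (etrans (esym tE) P0) => pt0; rewrite pt0 ltxx in pt.
by move=> Poo; have := etrans (esym tE) Poo.
Qed.

Lemma joint_cdf_truncated x : 0 < joint_cdf P U t ->
  joint_cdf (truncated_prob P U t) U x =
  joint_cdf P U (fun j => Num.min (x j) (t j)) / joint_cdf P U t.
Proof.
move=> pt; rewrite {1}/joint_cdf truncated_probE// (_ : _ `&` _ =
  lower_event U (fun j => Num.min (x j) (t j))) ?joint_cdfE//.
apply/seteqP; split=> [w [xw tw] j|w xtw]; first by rewrite le_min xw tw.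
by split=> j; have := xtw j; rewrite le_min => /andP[].
Qed.

Lemma margin_cdf_truncated j y : 0 < joint_cdf P U t ->
  margin_cdf (truncated_prob P U t) U j y =
  joint_cdf P U (update t j (Num.min y (t j))) / joint_cdf P U t.
Proof.
move=> pt; apply: EFin_inj; rewrite -margin_cdfE truncated_probE//.
rewrite (_ : _ `&` _ = lower_event U (update t j (Num.min y (t j)))) ?joint_cdfE//.
apply/seteqP; split=> [w [/= yw tw] k|w uw].
  by rewrite /update; case: eqP => // ->; rewrite le_min yw tw.
split=> [|k] /=; first by have := uw j; rewrite /update eqxx le_min => /andP[].
by have := uw k; rewrite /update; case: eqP => [->|//]; rewrite le_min => /andP[].
Qed.

(** A uniform variable is almost surely positive, so that [U j <= x] and
    [U j <= 0] are both null events when [x < 0]. *)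
Lemma joint_cdf_max0 C x : distributed_as P U C ->
  joint_cdf P U x = joint_cdf P U (fun j => Num.max 0 (x j)).
Proof.
move=> [unifU _]; apply: EFin_inj; rewrite -!joint_cdfE.
apply: (@measure_forall_null _ _ _ P d (fun j => [set w | U j w <= x j])
  (fun j => [set w | U j w <= Num.max 0 (x j)])) => j.
- exact: measurable_margin_event.
- exact: measurable_margin_event.
- by move=> w /= Uw; rewrite le_max Uw orbT.
have mD : measurable
    ([set w | U j w <= Num.max 0 (x j)] `\` [set w | U j w <= x j]).
  by apply: measurableD; exact: measurable_margin_event.
apply/eqP; rewrite eq_le measure_ge0 andbT.
have <- : P [set w | U j w <= 0] = 0%E.
  have /= := unifU j _ (measurable_itv `]-oo, 0]).
  by rewrite uniform_prob_itvNy ?lexx ?ler01.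
apply: le_measure; rewrite ?inE//; first exact: measurable_margin_event.
by move=> w /= [+ /negP/negPf Ux]; rewrite le_max Ux orbF.
Qed.

End truncated_law.

Theorem theorem3p1 (R : realType) (d : nat) (psi : R -> R)
    (C : ('I_d -> R) -> R) (t : 'I_d -> R)
    (hpsi : Psi d psi) (hC : is_archimedean psi C)
    (ht : forall j, 0 < t j <= 1) (hCt : 0 < C t)
    (dT : measure_display) (T : measurableType dT) (P : probability T R)
    (U : 'I_d -> {mfun T >-> R}) (hU : distributed_as P U C) :
  let c := C t in
  let tpsi := fun x : R => gen_ext psi (x%:E + gen_inv psi c)%E / c in
  [/\ forall u : R, 0 <= u <= 1 ->
        gen_inv tpsi u = (gen_inv psi (c * u) - gen_inv psi c)%E,
      exists h : R, [/\ h%:E = gen_inv psi c, 0 <= h, 0 < psi h &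
        forall x : R, 0 <= x -> tpsi x = tilted psi h x],
      exists Ct : ('I_d -> R) -> R, right_truncated_copula P U t Ct &
      forall Ct : ('I_d -> R) -> R, right_truncated_copula P U t Ct ->
        (forall u : 'I_d -> R, unit_cube u ->
           Ct u = gen_ext psi ((\sum_(j < d) gen_inv psi (c * u j))
                               - (d%:R - 1)%:E * gen_inv psi c)%E / c /\
           Ct u = gen_ext tpsi (\sum_(j < d) gen_inv tpsi (u j))%E) /\
        is_archimedean tpsi Ct].
Proof.
move=> c tpsi; have [gen _ Carch] := hC.
have t01 : unit_cube t by move=> j; have /andP[/ltW -> ->] := ht j.
have [a aP] := choice (fun j => gen_inv_pos gen (ht j)).
have a0 j : 0 <= a j by have [] := aP j.
have ta j : gen_inv psi (t j) = (a j)%:E by have [] := aP j.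
pose h := \sum_(j < d) a j.
have h0 : 0 <= h by exact: sumr_ge0.
have cE : c = psi h.
  by rewrite /c Carch// /archimedean (eq_bigr _ (fun j _ => ta j)) sumEFin.
have ph : 0 < psi h by rewrite -cE.
have hE : gen_inv psi c = h%:E by rewrite cE gen_invE.
have tpsiE : tpsi = tilted psi h by apply/funext => x; rewrite /tpsi hE cE.
have jc y : unit_cube y -> joint_cdf P U y = archimedean psi y.
  by move=> y01; rewrite hU.2// Carch.
have jct : joint_cdf P U t = psi h by rewrite jc// -Carch.
have jt0 : 0 < joint_cdf P U t by rewrite jct.
(* The conditional law has no mass in coordinate [j] outside of the
   interval from 0 to [t j]. *)
pose clip j x := Num.max 0 (Num.min x (t j)).
have clipP j x : 0 <= clip j x <= t j.
  have /andP[/ltW t0 _] := ht j.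
  by rewrite /clip le_max lexx ge_max t0 ge_min lexx orbT.
have cube y : (forall j, 0 <= y j <= t j) -> unit_cube y.
  move=> yt j; have /andP[-> yj] := yt j; have /andP[_] := ht j.
  exact: le_trans.
have updateP j y : 0 <= y <= t j -> forall k, 0 <= update t j y k <= t k.
  move=> yj k; rewrite /update; case: eqP => [->//|_].
  by rewrite lexx; have /andP[/ltW -> _] := ht k.
pose Q := truncated_prob P U t.
have jointQ x : joint_cdf Q U x = archimedean psi (fun j => clip j (x j)) / psi h.
  rewrite joint_cdf_truncated// (joint_cdf_max0 _ hU) jct jc//.
  by apply: cube => j; exact: clipP.
have marginQ j x :
    margin_cdf Q U j x = archimedean psi (update t j (clip j x)) / psi h.
  rewrite margin_cdf_truncated// (joint_cdf_max0 _ hU) jct.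
  rewrite (_ : (fun k => _) = update t j (clip j x)); last first.
    apply/funext => k; rewrite /update/clip; case: eqP => // _.
    by apply: max_idPr; have /andP[/ltW] := ht k.
  by rewrite jc//; apply: cube; exact: updateP (clipP j x).
have onto j v : 0 <= v <= 1 -> exists x, margin_cdf Q U j x = v.
  move=> v01; have [y [/andP[y0 yt] yv]] := margin_onto gen ht a0 ta ph j v01.
  exists y; rewrite marginQ /clip (min_idPl yt) (max_idPr y0) yv.
  by rewrite mulrC mulKf ?gt_eqF.
have sklar x :
    joint_cdf Q U x = archimedean (tilted psi h) (fun j => margin_cdf Q U j (x j)).
  rewrite jointQ (archimedean_truncated gen ht a0 ta ph)//.
  by congr archimedean; apply/funext => j; rewrite marginQ.
split.
- by move=> u u01; rewrite tpsiE hE cE gen_inv_tilted.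
- by exists h; split=> // x _; rewrite tpsiE.
- exists (archimedean (tilted psi h)); split; last exact: sklar.
  exact: is_copula_margins onto _ sklar.
move=> Ct [copCt CtE].
have CtA u : unit_cube u -> Ct u = archimedean tpsi u.
  by move=> u01; rewrite tpsiE; exact: (copula_of_unique onto CtE sklar u01).
split; last by split=> //; rewrite tpsiE; exact: is_generator_tilted.
move=> u u01; split; last exact: CtA.
by rewrite CtA// tpsiE hE cE archimedean_tiltedE.
Qed.
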